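(* The set $Z$ is outer approximated by $Z_{\mathrm{VaR}}$, i.e. $Z\subseteq Z_{\mathrm{VaR}}$, where $$Z_{\mathrm{VaR}}=\left\{x\in\mathbb{R}^n:\ \mathbb{P}_{\tilde\zeta}\left\{\frac{\delta}{\epsilon}\|a(x)\|_*+a(x)^\top\tilde\zeta_i\le b_i(x),\ \forall i\in[I]\right\}\ge1-\epsilon\right\}.$$
   Context: Let $n,I,N$ be positive integers, $[R]:=\{1,\dots,R\}$, $\epsilon\in(0,1)$, $\delta>0$. Let $\eta_1,\eta_2\in\{0,1\}$ with $\eta_1+\eta_2\ge1$. For $x\in\mathbb{R}^n$ let $a(x)=\begin{pmatrix}\eta_1x\\ \eta_2\end{pmatrix}\in\mathbb{R}^{n+1}$ and, for $i\in[I]$, $b_i(x)=B_i^\top x+b^i$ with given $B_i\in\mathbb{R}^n$, $b^i\in\mathbb{R}$. The uncertain parameter $\xi=(\xi_1,\dots,\xi_I)$, $\xi_i\in\mathbb{R}^{n+1}$, takes values in $\Xi=\mathbb{R}^{I\times(n+1)}$, equipped with a norm $\|\cdot\|$. For $a\in\mathbb{R}^{n+1}$ the dual norm is $\|a\|_*=\sup\{a^\top u_i:\ u=(u_1,\dots,u_I)\in\Xi,\ \|u\|\le1\}$, where the norm is such that this value does not depend on $i\in[I]$ (as for any $L_p$ norm). Samples $\zeta^1,\dots,\zeta^N\in\Xi$, $\zeta^j=(\zeta^j_1,\dots,\zeta^j_I)$, are given (realizations of i.i.d. samples from a true distribution); the random vector $\tilde\zeta=(\tilde\zeta_1,\dots,\tilde\zeta_I)$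 has the empirical distribution $\mathbb{P}_{\tilde\zeta}$, which gives mass $1/N$ to each $\zeta^j$, $j\in[N]$. The Wasserstein distance of probability distributions on $\Xi$ is $$W(\mathbb{P}_1,\mathbb{P}_2)=\inf\left\{\int_{\Xi\times\Xi}\|\xi_1-\xi_2\|\,\mathbb{Q}(d\xi_1,d\xi_2):\ \mathbb{Q}\text{ a joint distribution with marginals }\mathbb{P}_1,\mathbb{P}_2\right\},$$ and the ambiguity set is $\mathcal{P}=\{\mathbb{P}:\ \mathbb{P}\{\tilde\xi\in\Xi\}=1,\ W(\mathbb{P},\mathbb{P}_{\tilde\zeta})\le\delta\}$. Define $$Z=\left\{x\in\mathbb{R}^n:\ \inf_{\mathbb{P}\in\mathcal{P}}\mathbb{P}\left\{\tilde\xi:\ a(x)^\top\tilde\xi_i\le b_i(x),\ \forall i\in[I]\right\}\ge1-\epsilon\right\}.$$ *)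

(* Defs.v *)
From HB Require Import structures.
From mathcomp Require Import all_boot all_order all_algebra.
From mathcomp Require Import all_classical all_reals all_analysis.
Set Implicit Arguments.
Unset Strict Implicit.
Unset Printing Implicit Defensive.
Import Order.TTheory GRing.Theory Num.Theory.
Import numFieldNormedType.Exports.
Local Open Scope classical_set_scope.
Local Open Scope ring_scope.

(* The matrices 'M[R]_(I, m) with their Borel sigma-algebra; row [i] of such a
   matrix xi is the component xi_i in R^m.  The open sets are those of the
   standard topology, which every norm induces as the dimension is finite. *)
Notation Xi R I m := (g_sigma_algebraType (@open 'M[R]_(I, m))).

(* The norm is arbitrary, unrelated to the canonical max norm [`|_|] of
   matrices, hence a predicate on functions. *)
Definition is_norm (R : realType) (V : lmodType R) (nrm : V -> R) : Prop :=
  [/\ forall u v, nrm (u + v) <= nrm u + nrm v,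
      forall (t : R) u, nrm (t *: u) = `|t| * nrm u
    & forall u, nrm u = 0 -> u = 0].

(* The product [a^T xi_i]. *)
Definition dot_row (R : realType) (I m : nat) (a : 'cV[R]_m)
    (xi : 'M[R]_(I, m)) (i : 'I_I) : R :=
  (row i xi *m a) 0 0.

Definition dual_norm_at (R : realType) (I m : nat) (nrm : 'M[R]_(I, m) -> R)
    (i : 'I_I) (a : 'cV[R]_m) : R :=
  sup [set dot_row a u i | u in [set u : 'M[R]_(I, m) | nrm u <= 1]].

Definition avec (R : realType) (n : nat) (eta1 eta2 : bool) (x : 'cV[R]_n) :
    'cV[R]_(n + 1) :=
  col_mx (eta1%:R *: x) (eta2%:R%:M).

Definition brhs (R : realType) (n I : nat) (B : 'I_I -> 'cV[R]_n)
    (b : 'I_I -> R) (i : 'I_I) (x : 'cV[R]_n) : R :=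
  ((B i)^T *m x) 0 0 + b i.

Definition is_coupling (R : realType) (d : measure_display)
    (T : measurableType d) (P1 P2 : probability T R)
    (Q : probability (T * T)%type R) : Prop :=
  forall A : set T, measurable A ->
    Q (fst @^-1` A) = P1 A /\ Q (snd @^-1` A) = P2 A.

Definition wasserstein (R : realType) (I m : nat) (nrm : 'M[R]_(I, m) -> R)
    (P1 P2 : probability (Xi R I m) R) : \bar R :=
  ereal_inf [set (\int[Q]_z
      (nrm ((z.1 : 'M[R]_(I, m)) - (z.2 : 'M[R]_(I, m))))%:E)%E
    | Q in is_coupling P1 P2].

Section empirical.
Context (R : realType) (d : measure_display) (T : measurableType d) (N : nat).
Variables (N_gt0 : (0 < N)%N) (zeta : 'I_N -> T).

(* The proof of [0 < N] is only there for the probability instance below. *)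
Definition empirical of (0 < N)%N : set T -> \bar R :=
  fun A => ((N%:R^-1)%:E * \sum_(j < N) \d_(zeta j) A)%E.

Local Notation emp := (empirical N_gt0).

Let emp_measure : {measure set T -> \bar R} :=
  mscale (N%:R^-1)%:nng
    (msum (fun k => dirac (zeta (insubd (Ordinal N_gt0) k))) N).

Let empE : emp = emp_measure.
Proof.
apply/funext => A; rewrite /empirical /emp_measure /mscale /msum /=.
by congr (_ * _)%E; apply: eq_bigr => j _; rewrite valKd.
Qed.

Let emp0 : emp set0 = 0%E. Proof. by rewrite empE measure0. Qed.

Let emp_ge0 A : (0 <= emp A)%E. Proof. by rewrite empE measure_ge0. Qed.

Let emp_sigma_additive : semi_sigma_additive emp.
Proof. by rewrite empE; exact: measure_semi_sigma_additive. Qed.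

HB.instance Definition _ :=
  isMeasure.Build _ _ _ emp emp0 emp_ge0 emp_sigma_additive.

Let empT : emp setT = 1%E.
Proof.
rewrite /empirical (eq_bigr (fun=> (1%:R : R)%:E)); last first.
  by move=> j _; rewrite diracT.
rewrite sumEFin sumr_const card_ord -EFinM -[1%:R *+ _]mulr_natl mulr1.
by rewrite mulVf// pnatr_eq0 -lt0n.
Qed.

HB.instance Definition _ := Measure_isProbability.Build _ _ _ emp empT.

End empirical.

Arguments empirical {R d T N} zeta N_gt0 _.

Definition ambiguity_set (R : realType) (I m : nat) (nrm : 'M[R]_(I, m) -> R)
    (Phat : probability (Xi R I m) R) (delta : R) :
    set (probability (Xi R I m) R) :=
  [set P | (wasserstein nrm P Phat <= delta%:E)%E].

Definition Z_set (R : realType) (n I N : nat) (N_gt0 : (0 < N)%N)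
    (epsilon delta : R) (eta1 eta2 : bool)
    (B : 'I_I -> 'cV[R]_n) (b : 'I_I -> R) (nrm : 'M[R]_(I, n + 1) -> R)
    (zeta : 'I_N -> Xi R I (n + 1)) : set 'cV[R]_n :=
  [set x | ((1 - epsilon)%:E <=
    ereal_inf [set P [set xi | forall i : 'I_I,
                   (dot_row (avec eta1 eta2 x) xi i <= brhs B b i x)%R]
              | P in ambiguity_set nrm (empirical zeta N_gt0) delta])%E].

(* [dnorm] stands for the dual norm. *)
Definition Z_VaR (R : realType) (n I N : nat) (N_gt0 : (0 < N)%N)
    (epsilon delta : R) (eta1 eta2 : bool)
    (B : 'I_I -> 'cV[R]_n) (b : 'I_I -> R) (dnorm : 'cV[R]_(n + 1) -> R)
    (zeta : 'I_N -> Xi R I (n + 1)) : set 'cV[R]_n :=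
  [set x | ((1 - epsilon)%:E <=
    empirical zeta N_gt0 [set xi : Xi R I (n + 1) | forall i : 'I_I,
      (delta / epsilon * dnorm (avec eta1 eta2 x)
        + dot_row (avec eta1 eta2 x) xi i <= brhs B b i x)%R])%E].

(* Main.v *)
From HB Require Import structures.
Require Import Defs.
From mathcomp Require Import all_boot all_order all_algebra.
From mathcomp Require Import all_classical all_reals all_analysis.
From mathcomp Require Import measurable_realfun.
Set Implicit Arguments.
Unset Strict Implicit.
Unset Printing Implicit Defensive.
Import Order.TTheory GRing.Theory Num.Theory.
Import numFieldNormedType.Exports.
Local Open Scope classical_set_scope.
Local Open Scope ring_scope.

(** Let [V] be the set of parameters that satisfy the constraints with the
    margin [delta / epsilon * dnorm a], and suppose that the samples outside
    [V] have empirical mass [r > epsilon].  An adversary with transport budget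
    [delta] can then violate the constraints with probability above
    [epsilon].  Each sample outside [V] fails some constraint [i] with the
    margin, so it violates that constraint after a displacement of norm below
    [delta / epsilon] along a direction almost attaining the dual norm at [i].

    Displacing all of these samples may exceed the budget, so only a mass [q]
    slightly above [epsilon] is moved, by at most [delta / q].  As [q] tends to
    [epsilon] from the right, [delta / q] tends to [delta / epsilon]; the
    violations are strict and finite in number, so one [q] serves all samples
    ([common_moved_mass]).  The adversarial distribution is the mixture of the
    empirical distributions of the original and of the displaced samples, with
    weight [q / r] on the latter.  Its transport cost is at most
    [q / r * r * (delta / q) = delta] ([wasserstein_mixture_le]), and it gives
    the constraints probability at most [1 - q / r * r = 1 - q < 1 - epsilon].

    The integrals occurring here are against finitely supported measures and
    only upper bounds on them are required.  These hold for every nonnegative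
    integrand, measurable or not, since the integral is a supremum over
    measurable simple minorants ([ge0_integral_le_nnsfun]); this settles the
    transport cost without comparing the product of the two Borel
    sigma-algebras with the Borel sigma-algebra of the product. *)

(** * Mixtures and empirical measures *)

Section discrete_measures.
Import HBNNSimple.
Context {R : realType} {d : measure_display} {T : measurableType d}.

(** Brings the rules for measurable integrands to bear on an arbitrary [f],
    through its simple minorants. *)
Lemma ge0_integral_le_nnsfun (mu : {measure set T -> \bar R}) (f : T -> \bar R)
    (M : \bar R) : (forall x, 0 <= f x)%E ->
  (forall h : {nnsfun T >-> R}, (forall x, (h x)%:E <= f x)%E ->
     (\int[mu]_x (h x)%:E <= M)%E) ->
  (\int[mu]_x f x <= M)%E.
Proof.
move=> f0 hM; rewrite ge0_integralTE//; apply: ge_ereal_sup => _ [h hf <-].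
by rewrite -integralT_nnsfun; exact: hM.
Qed.

Definition mixture (s t : {nonneg R}) (P1 P2 : probability T R) :
    {measure set T -> \bar R} :=
  measure_add (mscale s P1) (mscale t P2).

Lemma mixtureE s t P1 P2 A :
  mixture s t P1 P2 A = (s%:num%:E * P1 A + t%:num%:E * P2 A)%E.
Proof. exact: measure_addE. Qed.

Lemma mixture_exists (t : R) (P1 P2 : probability T R) : 0 <= t <= 1 ->
  exists P : probability T R,
    forall A, P A = ((1 - t)%:E * P1 A + t%:E * P2 A)%E.
Proof.
move=> /andP[t0 t1]; have t1' : 0 <= 1 - t by rewrite subr_ge0.
pose mu := mixture (NngNum t1') (NngNum t0) P1 P2.
have muT : mu setT = 1%E.
  by rewrite mixtureE/= !probability_setT !mule1 -EFinD subrK.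
pose m := Measure_isProbability.Build _ _ _ mu muT.
exists (HB.pack_for (probability T R) (Measure.sort mu) m) => A.
exact: mixtureE.
Qed.

(** Only an inequality, because [f] need not be measurable: a simple minorant
    of [f] has the same integral against [P] as against the mixture, but the
    suprema for [P1] and [P2] are taken independently. *)
Lemma integral_mixture_le (t : R) (P P1 P2 : probability T R)
    (f : T -> \bar R) : 0 <= t <= 1 ->
  (forall A, P A = ((1 - t)%:E * P1 A + t%:E * P2 A)%E) ->
  (forall x, 0 <= f x)%E ->
  (\int[P]_x f x <= (1 - t)%:E * \int[P1]_x f x + t%:E * \int[P2]_x f x)%E.
Proof.
move=> /andP[t0 t1] PE f0; have t1' : 0 <= 1 - t by rewrite subr_ge0.
apply: ge0_integral_le_nnsfun => // h hf.
have h0 x : (0 <= (h x)%:E)%E by rewrite lee_fin.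
have mh : measurable_fun setT (fun x => (h x)%:E) by exact/measurable_EFinP.
rewrite (eq_measure_integral (mixture (NngNum t1') (NngNum t0) P1 P2)).
  rewrite ge0_integral_measure_add// !ge0_integral_mscale//=.
  have hle (Q : probability T R) : (\int[Q]_x (h x)%:E <= \int[Q]_x f x)%E.
    rewrite integralT_nnsfun ge0_integralTE//.
    by apply: ereal_sup_ubound; exists h.
  by apply: leeD; apply: lee_wpmul2l; rewrite ?lee_fin.
by move=> A _ _; rewrite mixtureE; exact: PE.
Qed.

Lemma empiricalE (N : nat) (N_gt0 : (0 < N)%N) (z : 'I_N -> T) (A : set T) :
  empirical (R := R) z N_gt0 A = (N%:R^-1 * \sum_(j < N) \1_A (z j))%:E.
Proof. by rewrite /empirical EFinM -sumEFin. Qed.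

Lemma integral_empirical_le (N : nat) (N_gt0 : (0 < N)%N) (z : 'I_N -> T)
    (f : T -> R) : (forall x, 0 <= f x) ->
  (\int[empirical z N_gt0]_x (f x)%:E
     <= (N%:R^-1 * \sum_(j < N) f (z j))%:E)%E.
Proof.
move=> f0; apply: ge0_integral_le_nnsfun => [x|h hf]; first by rewrite lee_fin.
have h0 x : (0 <= (h x)%:E)%E by rewrite lee_fin.
have mh : measurable_fun setT (fun x => (h x)%:E) by exact/measurable_EFinP.
rewrite (eq_measure_integral (mscale (N%:R^-1)%:nng
  (msum (fun k => dirac (z (insubd (Ordinal N_gt0) k))) N))); last first.
  move=> A _ _; rewrite /empirical /mscale /msum /=.
  by congr (_ * _)%E; apply: eq_bigr => j _; rewrite valKd.
rewrite ge0_integral_mscale// ge0_integral_measure_sum//= EFinM.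
apply: lee_wpmul2l; first by rewrite lee_fin invr_ge0.
rewrite -sumEFin; apply: lee_sum => j _.
by rewrite integral_dirac//= diracT mul1e valKd; exact: hf.
Qed.

End discrete_measures.

(** * Norms and dual norms *)

Lemma is_norm0 (R : realType) (V : lmodType R) (nrm : V -> R) :
  is_norm nrm -> nrm 0 = 0.
Proof. by case=> _ nZ _; rewrite -(scale0r 0) nZ normr0 mul0r. Qed.

Lemma is_norm_ge0 (R : realType) (V : lmodType R) (nrm : V -> R) :
  is_norm nrm -> forall u, 0 <= nrm u.
Proof.
move=> nrmP u; case: (nrmP) => nD nZ _; have := nD u (- u).
rewrite subrr (is_norm0 nrmP) -scaleN1r nZ normrN normr1 mul1r -mulr2n.
by rewrite pmulrn_lge0.
Qed.

Section dual_norm.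
Context {R : realType} {I m : nat}.

Lemma dot_rowD (a : 'cV[R]_m) (u v : 'M[R]_(I, m)) i :
  dot_row a (u + v) i = dot_row a u i + dot_row a v i.
Proof. by rewrite /dot_row linearD mulmxDl mxE. Qed.

Lemma dot_rowZ (a : 'cV[R]_m) t (u : 'M[R]_(I, m)) i :
  dot_row a (t *: u) i = t * dot_row a u i.
Proof. by rewrite /dot_row linearZ/= -scalemxAl mxE. Qed.

(** Near-maximizers of the dual norm are enough, as the constraint violations to
    be produced are strict. *)
Lemma dual_norm_at_gt (nrm : 'M[R]_(I, m) -> R) i a c : is_norm nrm ->
  c < dual_norm_at nrm i a -> exists2 u, nrm u <= 1 & c < dot_row a u i.
Proof.
move=> nrmP; rewrite /dual_norm_at => /sup_gt[]; last first.
  by move=> _ [u u1 <-] cu; exists u.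
by exists (dot_row a 0 i), 0 => //=; rewrite is_norm0.
Qed.

End dual_norm.

(** * The adversarial distribution *)

(** The inequalities are strict and finite in number, so they survive a small
    increase of [e]: a mass slightly above [e] can be displaced far
    enough to violate the constraints at every sample in question. *)
Lemma common_moved_mass (R : realType) (J : finType) (A : pred J)
    (e r delta : R) (s c : J -> R) : e < r ->
  (forall j, A j -> e * c j < delta * s j) ->
  exists2 q, e < q < r & forall j, A j -> q * c j < delta * s j.
Proof.
move=> er H.
have near_q : \forall q \near e^'+, forall j, A j -> q * c j < delta * s j.
  apply: filter_forall => j.
  case: (boolP (A j)) => [Aj|_]; last by apply: nearW.
  have cvge : (fun q => q * c j) @ e^'+ --> e * c j.
    by apply: cvg_at_right_filter; apply: cvgMl; exact: cvg_id.
  by near=> q => _; near: q; apply: (cvgr_lt _ cvge); exact: H.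
near (e^'+) => q; exists q; last by near: q.
by apply/andP; split; near: q; [exact: nbhs_right_gt|exact: nbhs_right_lt].
Unshelve. all: by end_near.
Qed.

(** The coupling leaves a fraction [1 - t] of each sample in place and sends the
    fraction [t] to the displaced sample. *)
Lemma wasserstein_mixture_le (R : realType) (I m N : nat) (N_gt0 : (0 < N)%N)
    (nrm : 'M[R]_(I, m) -> R) (z z' : 'I_N -> Xi R I m) (t : R)
    (P : probability (Xi R I m) R) : is_norm nrm -> 0 <= t <= 1 ->
  (forall A, P A = ((1 - t)%:E * empirical z N_gt0 A
                    + t%:E * empirical z' N_gt0 A)%E) ->
  (wasserstein nrm P (empirical z N_gt0)
     <= (t * (N%:R^-1 * \sum_(j < N)
           nrm ((z' j : 'M[R]_(I, m)) - (z j : 'M[R]_(I, m)))))%:E)%E.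
Proof.
move=> nrmP t01 PE; set C := (X in (_ <= X)%E).
have [Q QE] := mixture_exists
  (empirical (fun j => (z j, z j)) N_gt0 : probability _ R)
  (empirical (fun j => (z' j, z j)) N_gt0 : probability _ R) t01.
have cQ : is_coupling P (empirical z N_gt0) Q.
  move=> A mA; split; first by rewrite QE PE.
  rewrite QE /= -[X in (_ * X)%E]/(empirical z N_gt0 A).
  rewrite -[X in (_ + _ * X)%E]/(empirical z N_gt0 A).
  by rewrite !empiricalE -!EFinM -EFinD -mulrDl subrK mul1r.
apply: (@le_trans _ _ (\int[Q]_w
    (nrm ((w.1 : 'M[R]_(I, m)) - (w.2 : 'M[R]_(I, m))))%:E)%E).
  by apply: ereal_inf_lbound; exists Q.
pose f (w : Xi R I m * Xi R I m) :=
  nrm ((w.1 : 'M[R]_(I, m)) - (w.2 : 'M[R]_(I, m))).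
have f0 w : 0 <= f w by exact: (is_norm_ge0 nrmP).
apply: (le_trans (integral_mixture_le t01 QE (f := EFin \o f) _)) => //.
case/andP: t01 => t0 t1.
have -> : C = ((1 - t)%:E * (N%:R^-1 * \sum_(j < N) f (z j, z j))%:E
             + t%:E * (N%:R^-1 * \sum_(j < N) f (z' j, z j))%:E)%E.
  rewrite [X in (_ * (_ * X)%:E + _)%E]big1 ?mulr0 ?mule0 ?add0e// => j _.
  by rewrite /f subrr (is_norm0 nrmP).
apply: leeD; apply: lee_wpmul2l; rewrite ?lee_fin ?subr_ge0//;
  exact: integral_empirical_le.
Qed.

Theorem theorem3 (R : realType) (n I N : nat)
  (n_gt0 : (0 < n)%N) (I_gt0 : (0 < I)%N) (N_gt0 : (0 < N)%N)
  (epsilon delta : R)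
  (epsilon_gt0 : 0 < epsilon) (epsilon_lt1 : epsilon < 1)
  (delta_gt0 : 0 < delta)
  (eta1 eta2 : bool) (eta_ge1 : (1 <= eta1 + eta2)%N)
  (B : 'I_I -> 'cV[R]_n) (b : 'I_I -> R)
  (nrm : 'M[R]_(I, n + 1) -> R) (nrm_norm : is_norm nrm)
  (dnorm : 'cV[R]_(n + 1) -> R)
  (dnormE : forall (i : 'I_I) (a : 'cV[R]_(n + 1)),
     dnorm a = dual_norm_at nrm i a)
  (zeta : 'I_N -> Xi R I (n + 1)) :
  Z_set N_gt0 epsilon delta eta1 eta2 B b nrm zeta
    `<=` Z_VaR N_gt0 epsilon delta eta1 eta2 B b dnorm zeta.
Proof.
move=> x; rewrite /Z_set /Z_VaR /=.
set a := avec eta1 eta2 x.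
set G := [set xi | forall i, dot_row a xi i <= brhs B b i x].
set V := (X in _ -> (_ <= empirical zeta N_gt0 X)%E) => Zx.
(* The violated margin multiplied by [epsilon], with a near-maximizer [u] in
   place of the dual norm. *)
have exit_direction j : zeta j \notin V -> exists i, exists2 u, nrm u <= 1 &
    epsilon * (brhs B b i x - dot_row a (zeta j) i) < delta * dot_row a u i.
  rewrite notin_setE => /existsNP[i /negP]; rewrite -ltNge => viol.
  have : epsilon * (brhs B b i x - dot_row a (zeta j) i) / delta
      < dual_norm_at nrm i a.
    rewrite ltr_pdivrMr// -dnormE -ltr_pdivlMl//.
    by rewrite ltrBlDr [epsilon^-1 * _]mulrC [dnorm a * _]mulrC mulrAC.
  move=> H; have [u u1 cu] := dual_norm_at_gt nrm_norm H; exists i, u => //.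
  by rewrite -ltr_pdivrMl// mulrC.
have /choice[iu iuP] j : exists p : 'I_I * 'M[R]_(I, n + 1),
    zeta j \notin V -> nrm p.2 <= 1 /\
    epsilon * (brhs B b p.1 x - dot_row a (zeta j) p.1)
      < delta * dot_row a p.2 p.1.
  have [jV|/exit_direction[i [u u1 cu]]] := boolP (zeta j \in V); last first.
    by exists (i, u).
  by exists (Ordinal I_gt0, 0).
rewrite leNgt; apply/negP; rewrite empiricalE lte_fin.
set g := (X in X < _) => gV.
have er : epsilon < 1 - g by rewrite ltrBrDl -ltrBrDr.
have [q /andP[e_q q_r] qP] := common_moved_mass
  (A := fun j => zeta j \notin V) er (fun j jV => (iuP j jV).2).
have q_gt0 : 0 < q by exact: lt_trans e_q.
have r_gt0 : 0 < 1 - g by exact: lt_trans q_r.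
(* [1 - g] is the mass of the samples outside V: displacing the fraction [t] of
   each of them moves the mass [q] in total. *)
pose t := q / (1 - g).
have t01 : 0 <= t <= 1.
  by rewrite ler_pdivrMr// mul1r (ltW q_r) divr_ge0// ltW.
have step_ge0 : 0 <= delta / q by rewrite divr_ge0// ltW.
pose z' j : Xi R I (n + 1) := if zeta j \in V then zeta j else
  (zeta j : 'M[R]_(I, n + 1)) + (delta / q) *: (iu j).2.
have z'G j : z' j \in G -> zeta j \in V.
  rewrite /z'; case: ifPn => // jV /set_mem /(_ (iu j).1).
  rewrite leNgt => /negP[]; rewrite dot_rowD dot_rowZ -ltrBlDl.
  by rewrite mulrAC ltr_pdivlMr// mulrC; exact: qP.
have [P PE] := mixture_exists (empirical zeta N_gt0 : probability _ R)
  (empirical z' N_gt0 : probability _ R) t01.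
have PA : ambiguity_set nrm (empirical zeta N_gt0) delta P.
  rewrite /ambiguity_set /=.
  apply: (le_trans (wasserstein_mixture_le nrm_norm t01 PE)).
  rewrite lee_fin.
  apply: (@le_trans _ _ (t * (N%:R^-1 *
      \sum_(j < N) (1 - \1_V (zeta j)) * (delta / q)))).
    apply: ler_wpM2l; first by case/andP: t01.
    apply: ler_wpM2l; first by rewrite invr_ge0.
    apply: ler_sum => j _; rewrite /z' indicE; case: ifPn => [jV|jV] /=.
      by rewrite subrr is_norm0// subrr mul0r.
    rewrite addrC addKr subr0 mul1r; case: (nrm_norm) => _ -> _.
    rewrite (ger0_norm step_ge0) ler_piMr//.
    exact: (iuP j jV).1.
  rewrite -mulr_suml sumrB sumr_const card_ord [N%:R^-1 * _]mulrA mulrBr.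
  rewrite mulVf ?pnatr_eq0 -?lt0n// -/g /t mulrA divfK ?gt_eqF//.
  by rewrite mulrCA divff ?mulr1// gt_eqF.
have := le_trans Zx (ereal_inf_lbound (ex_intro2 _ _ P PA erefl)).
rewrite PE /= !empiricalE -!EFinM -EFinD lee_fin leNgt => /negP; apply.
set g1 := (X in (1 - t) * X); set g2 := (X in _ + t * X).
have g1_le1 : g1 <= 1.
  rewrite /g1 mulrC ler_pdivrMr ?ltr0n// mul1r.
  have -> : N%:R = \sum_(j < N) 1 :> R by rewrite sumr_const card_ord.
  by apply: ler_sum => j _; rewrite indicE lern1 leq_b1.
have g2_leg : g2 <= g.
  apply: ler_wpM2l; first by rewrite invr_ge0.
  apply: ler_sum => j _; rewrite !indicE ler_nat.
  by case: (boolP (z' j \in G)) => // /z'G ->.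
case/andP: t01 => t0 t1.
apply: (@le_lt_trans _ _ ((1 - t) * 1 + t * g)).
  by apply: lerD; apply: ler_wpM2l => //; rewrite subr_ge0.
have -> : (1 - t) * 1 + t * g = 1 - t * (1 - g).
  by rewrite mulr1 mulrBr mulr1 opprB addrA addrAC.
by rewrite /t divfK ?gt_eqF// ltrD2l ltrN2.
Qed.
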